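(* Consider $\ell_2$-adversarial least squares and suppose $K$ has $n$ distinct eigenvalues $\lambda_n<\dots<\lambda_1$ ($0<n\le d$), each with algebraic multiplicity $\#\lambda_j$. Let $J_+=\{j:\lambda_j>0\}$. Then the learning rate schedule of exact line search, for all $t\ge0$ where $\mathcal E(t)>0$, is given by $$\gamma^{\mathrm{line}}(t)=\frac{\sum_{j=1}^n\alpha_j(t)\big(\lambda_j+\tilde\lambda^{\mathrm{eff}}(t)\big)}{\sum_{j=1}^n\frac{\#\lambda_j}d\lambda_j\big(\lambda_j+\tilde\lambda^{\mathrm{eff}}(t)\big)}\left(1-\frac{\Phi_{\min}(\tilde\lambda^{\mathrm{eff}}(t))}{\Phi_{\tilde\lambda^{\mathrm{eff}}(t)}(t)}\right).$$ Here $\Phi_{\tilde\lambda^{\mathrm{eff}}(t)}(t)=\mathsf R(t)+\frac{\tilde\lambda^{\mathrm{eff}}(t)}2\widehat{\mathsf B}_{44}(t)$ is the ridge regression objective with fixed parameter $\tilde\lambda^{\mathrm{eff}}(t)$, and $$\Phi_{\min}(\tilde\lambda^{\mathrm{eff}}(t))=\frac12\sum_{j\in J_+}\lambda_j\frac{\tilde\lambda^{\mathrm{eff}}(t)}{\lambda_j+\tilde\lambda^{\mathrm{eff}}(t)}\mathsf V_{j,22}(t)+\frac{\eta^2}2$$ is its minimum. Moreover $$\mathcal E_j(t)=\frac12\Big((\lambda_j+\tilde\lambda^{\mathrm{eff}}(t))\mathsf V_{j,11}(t)-2\lambda_j\mathsf V_{j,12}(t)+\frac{\lambda_j^2}{\lambda_j+\tilde\lambda^{\mathrm{eff}}(t)}\mathsf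 V_{j,22}(t)\Big)$$ denotes the $\lambda_j$-eigenspace's contribution to the excess risk $\mathcal E(t)=\Phi_{\tilde\lambda^{\mathrm{eff}}(t)}(t)-\Phi_{\min}(\tilde\lambda^{\mathrm{eff}}(t))$, such that $\mathcal E(t)=\sum_{j=1}^n\mathcal E_j(t)$, and $0\le\alpha_j(t)=\mathcal E_j(t)/\mathcal E(t)\le1$ for $1\le j\le n$. In the isotropic setting (all eigenvalues of $K$ equal), the learning rate schedule further simplifies to $$\gamma^{\mathrm{line}}(t)=1-\frac{\Phi_{\min}(\tilde\lambda^{\mathrm{eff}}(t))}{\Phi_{\tilde\lambda^{\mathrm{eff}}(t)}(t)}.$$ When $\mathcal E(t)=0$, the optimum has been reached.
   Context: Setting: $\ell_2$-adversarial least squares on a single class $a\sim\mathcal N(0,K)$, $K\in\mathbb R^{d\times d}$ a covariance matrix, target $(X^\star)^\top a+\epsilon$ with $X^\star\in\mathbb R^d$, $\epsilon\sim\mathcal N(0,\eta^2)$ independent of $a$, no explicit ridge penalty, adversarial radius $\delta>0$, initialization $X_0\in\mathbb R^d$. Index the distinct eigenvalues $\lambda_j$, $1\le j\le n$, with orthogonal eigenprojections $P_j$ of rank $\#\lambda_j$. The deterministic limit of SGD with learning rate $\gamma(t)$ is the ODE system for $\mathsf V_{j,11}$, $\mathsf V_{j,12}=\mathsf V_{j,21}$, with $\mathsf V_{j,22}\equiv\|P_jX^\star\|^2$, $\mathsf V_{j,11}(0)=\|P_jX_0\|^2$, $\mathsf V_{j,12}(0)=X_0^\top P_jX^\star$: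 $$\dot{\mathsf V}_{j,11}=-2\tilde\gamma^{\mathrm{eff}}(\lambda_j+\tilde\lambda^{\mathrm{eff}})\mathsf V_{j,11}+2\tilde\gamma^{\mathrm{eff}}\lambda_j\mathsf V_{j,12}+2\lambda_j\#\lambda_j\frac{\gamma^2}d\mathsf R^{\mathrm{Adv}},\qquad \dot{\mathsf V}_{j,12}=-\tilde\gamma^{\mathrm{eff}}(\lambda_j+\tilde\lambda^{\mathrm{eff}})\mathsf V_{j,12}+\tilde\gamma^{\mathrm{eff}}\lambda_j\mathsf V_{j,22},$$ where $$\mathsf R=\tfrac12\sum_j\lambda_j(\mathsf V_{j,11}-2\mathsf V_{j,12}+\mathsf V_{j,22})+\tfrac{\eta^2}2,\quad\widehat{\mathsf B}_{44}=\sum_j\mathsf V_{j,11},\quad \mathsf R^{\mathrm{Adv}}=\mathsf R+\delta\sqrt{\tfrac2\pi}\sqrt{2\widehat{\mathsf B}_{44}\mathsf R}+\tfrac{\delta^2}2\widehat{\mathsf B}_{44},$$ $q=\sqrt{\widehat{\mathsf B}_{44}/(2\mathsf R)}$, $\tilde\gamma^{\mathrm{eff}}=\gamma(1+\delta\sqrt{2/\pi}\,q)$, $\tilde\lambda^{\mathrm{eff}}=\dfrac{\delta^2+\delta\sqrt{2/\pi}\,q^{-1}}{1+\delta\sqrt{2/\pi}\,q}$, the dynamics being considered while $\mathsf R,\widehat{\mathsf B}_{44}>0$. At a given state at time $t$, $\frac{d}{dt}\mathsf R^{\mathrm{Adv}}(t)$ is a quadratic polynomial in the instantaneous learning rate $\gamma=\gamma(t)$;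 the exact line search learning rate $\gamma^{\mathrm{line}}(t)$ is the value of $\gamma$ minimizing $\frac{d}{dt}\mathsf R^{\mathrm{Adv}}(t)$.
   Formalization: The isotropic formula is false for K = cI with c ≠ 1: it is proved with an extra factor 1/c for every c ≠ 0, and as printed only for K = I; the line search formulas exclude K = 0, where the denominator vanishes and no minimizing learning rate exists. *)

(* Defs.v *)
From HB Require Import structures.
From mathcomp Require Import all_boot all_order all_algebra.
From mathcomp Require Import all_classical all_reals all_analysis.

Set Implicit Arguments.
Unset Strict Implicit.
Unset Printing Implicit Defensive.

Import Order.TTheory GRing.Theory Num.Theory.
Import numFieldNormedType.Exports.

Local Open Scope classical_set_scope.
Local Open Scope ring_scope.

Definition dotv (R : realType) (d : nat) (x y : 'cV[R]_d) : R :=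
  (x^T *m y) 0 0.

Definition sqnorm (R : realType) (d : nat) (x : 'cV[R]_d) : R := dotv x x.

Definition covariance_matrix (R : realType) (d : nat) (K : 'M[R]_d) : Prop :=
  K^T = K /\ forall x : 'cV[R]_d, 0 <= dotv x (K *m x).

(* Row spaces represent subspaces.  P and K are symmetric in every use below,
   so rows against columns makes no difference. *)
Definition orthogonal_projection (R : realType) (d : nat) (P E : 'M[R]_d)
    : Prop :=
  [/\ P^T = P, P *m P = P & (P == E)%MS].

Record model (R : realType) (d n : nat) := Model {
  cov : 'M[R]_d;
  eigval : 'I_n -> R;
  eigproj : 'I_n -> 'M[R]_d;
  target : 'cV[R]_d;          (* X^* *)
  noise : R;                  (* eta, the standard deviation of epsilon *)
  radius : R                  (* delta *)
}.

Record valid_model (R : realType) (d n : nat) (M : model R d n) : Prop := {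
  valid_cov : covariance_matrix (cov M);
  valid_decreasing : forall i j : 'I_n, (i < j)%N -> eigval M j < eigval M i;
  valid_spectrum : forall a : R,
    eigenvalue (cov M) a <-> exists j : 'I_n, a = eigval M j;
  valid_proj : forall j : 'I_n,
    orthogonal_projection (eigproj M j) (eigenspace (cov M) (eigval M j));
  valid_radius : 0 < radius M
}.

(* Algebraic multiplicity, i.e. as a root of the characteristic polynomial. *)
Definition mult (R : realType) (d n : nat) (M : model R d n) (j : 'I_n) : nat :=
  mup (eigval M j) (char_poly (cov M)).

(* V_{j,22} is constant along the dynamics, hence not part of the state. *)
Record state (R : realType) (n : nat) := State {
  V11 : 'I_n -> R;
  V12 : 'I_n -> R
}.

Section Model.
Context (R : realType) (d n : nat) (M : model R d n).
Implicit Types (v : state R n) (X : 'cV[R]_d) (l g : R).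

Definition V22 (j : 'I_n) : R := sqnorm (eigproj M j *m target M).

Definition state_of X : state R n :=
  State (fun j => sqnorm (eigproj M j *m X))
        (fun j => dotv X (eigproj M j *m target M)).

Definition risk v : R :=
  2^-1 * (\sum_(j < n) eigval M j * (V11 v j - 2 * V12 v j + V22 j))
  + noise M ^+ 2 / 2.

Definition B44 v : R := \sum_(j < n) V11 v j.

Definition adv_risk v : R :=
  risk v + radius M * Num.sqrt (2 / pi) * Num.sqrt (2 * B44 v * risk v)
  + radius M ^+ 2 / 2 * B44 v.

Definition q v : R := Num.sqrt (B44 v / (2 * risk v)).

Definition gamma_eff v g : R :=
  g * (1 + radius M * Num.sqrt (2 / pi) * q v).

Definition lambda_eff v : R :=
  (radius M ^+ 2 + radius M * Num.sqrt (2 / pi) * (q v)^-1)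
  / (1 + radius M * Num.sqrt (2 / pi) * q v).

(* The right-hand side of the ODE at state v with learning rate g. *)
Definition drift v g : state R n :=
  State
    (fun j => - 2 * gamma_eff v g * (eigval M j + lambda_eff v) * V11 v j
              + 2 * gamma_eff v g * eigval M j * V12 v j
              + 2 * eigval M j * (mult M j)%:R * (g ^+ 2 / d%:R) * adv_risk v)
    (fun j => - gamma_eff v g * (eigval M j + lambda_eff v) * V12 v j
              + gamma_eff v g * eigval M j * V22 j).

(* d/dt R^Adv at state v as a function of the instantaneous learning rate g:
   the derivative of R^Adv at v in the direction of the drift. *)
Definition adv_risk_rate v g : R :=
  derive1 (fun h : R => adv_risk
     (State (fun j => V11 v j + h * V11 (drift v g) j)
            (fun j => V12 v j + h * V12 (drift v g) j))) 0.

Definition is_line_search v g : Prop :=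
  forall g' : R, adv_risk_rate v g <= adv_risk_rate v g'.

(* Expected squared loss (1/2) E[(X^T a - X^{*T} a - epsilon)^2] for
   a ~ N(0, K), plus the ridge penalty. *)
Definition ridge_objective l X : R :=
  2^-1 * dotv (X - target M) (cov M *m (X - target M)) + noise M ^+ 2 / 2
  + l / 2 * sqnorm X.

Definition Phi l v : R := risk v + l / 2 * B44 v.

Definition Phi_min l : R :=
  2^-1 * (\sum_(j < n | 0 < eigval M j)
            eigval M j * (l / (eigval M j + l)) * V22 j)
  + noise M ^+ 2 / 2.

Definition excess v : R := Phi (lambda_eff v) v - Phi_min (lambda_eff v).

Definition excess_part v (j : 'I_n) : R :=
  2^-1 * ((eigval M j + lambda_eff v) * V11 v j
          - 2 * eigval M j * V12 v j
          + eigval M j ^+ 2 / (eigval M j + lambda_eff v) * V22 j).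

Definition alpha v (j : 'I_n) : R := excess_part v j / excess v.

End Model.

Definition right_derivative (R : realType) (f : R -> R) (t l : R) : Prop :=
  h^-1 * (f (t + h) - f t) @[h --> 0^'+] --> l.

(* V solves the ODE system on [0, T[ (T may be infinite), staying in the region
   where the vector field is defined.  Right derivatives of a continuous path
   coincide with ordinary ones when the learning rate gamma is continuous; they
   also cover t = 0 and piecewise constant schedules.  Without local boundedness
   of gamma the bound V_12^2 <= V_11 V_22 need not propagate from t = 0. *)
Record sgd_limit (R : realType) (d n : nat) (M : model R d n) (X0 : 'cV[R]_d)
    (gamma : R -> R) (T : \bar R) (V : R -> state R n) : Prop := {
  sgd_init : V 0 = state_of M X0;
  sgd_gamma : forall t : R, 0 <= t -> (t%:E < T)%E ->
    exists C : R, forall s : R, 0 <= s <= t -> `|gamma s| <= C;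
  sgd_risk : forall t : R, 0 <= t -> (t%:E < T)%E ->
    0 < risk M (V t) /\ 0 < B44 (V t);
  sgd_cont11 : forall j : 'I_n,
    {within [set t : R | 0 <= t /\ (t%:E < T)%E],
      continuous (fun t => V11 (V t) j)};
  sgd_cont12 : forall j : 'I_n,
    {within [set t : R | 0 <= t /\ (t%:E < T)%E],
      continuous (fun t => V12 (V t) j)};
  sgd_ode11 : forall (t : R) (j : 'I_n), 0 <= t -> (t%:E < T)%E ->
    right_derivative (fun s => V11 (V s) j) t (V11 (drift M (V t) (gamma t)) j);
  sgd_ode12 : forall (t : R) (j : 'I_n), 0 <= t -> (t%:E < T)%E ->
    right_derivative (fun s => V12 (V s) j) t (V12 (drift M (V t) (gamma t)) j)
}.

(* Main.v *)
(* Write [r = sqrt (2 R)] and [b = sqrt B].  Then [R^Adv] is a quadratic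
   polynomial in [(r, b)], and the effective ridge parameter is chosen so that, at
   the current state, both [R^Adv = c Phi] and [d R^Adv = c d Phi] hold with the same
   factor [c = gamma^eff / gamma].  Hence the rate is an explicit quadratic in the
   learning rate whose linear coefficient is a combination of the [E_j].
   Nonnegativity of [E_j] is a completed square once [V11 >= 0] and
   [V12^2 <= V11 V22]; both are propagated by the dynamics, because
   [D = V11 V22 - V12^2] satisfies [D' = - 2 gamma^eff (lambda_j + lambda^eff) D + f]
   with [f >= 0].  If the excess vanishes, every square does, so the state is that of
   the ridge minimizer; there the gradient of [R^Adv] vanishes too, and [R^Adv] is
   convex because [2 / pi <= 1]. *)
Require Import Defs.
From HB Require Import structures.
From mathcomp Require Import all_boot all_order all_algebra.
From mathcomp Require Import complex.
From mathcomp Require Import all_classical all_reals all_analysis.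
From mathcomp Require Import ring lra zify.

Set Implicit Arguments.
Unset Strict Implicit.
Unset Printing Implicit Defensive.

Import Order.TTheory GRing.Theory Num.Theory.
Import numFieldNormedType.Exports.

Local Open Scope classical_set_scope.
Local Open Scope ring_scope.

(** * Diagonalization of real symmetric matrices *)

Lemma diagonalizable_symmetric (R : rcfType) d (K : 'M[R]_d) :
  K^T = K -> diagonalizable K.
Proof.
case: d K => [|d] K sK; first by rewrite thinmx0; exact: diagonalizable0.
(* Over [R[i]] the matrix is Hermitian, hence unitarily diagonalizable with real eigenvalues; only a
   polynomial identity has to be carried back to [R]. *)
pose f := [the {rmorphism R -> R[i]} of real_complex R].
pose A := map_mx f K.
have Areal : A \is a realmx.
  by apply/mxOverP => i j; rewrite mxE; apply/complex_realP; exists (K i j).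
have Asym : A \is symmetricmx.
  by apply/is_hermitianmxP; rewrite expr0 scale1r map_mx_id// /A map_trmx sK.
have Aherm := realsym_hermsym Asym Areal.
have /orthomx_spectralP := hermitian_normalmx Aherm.
have /mxOverP := hermitian_spectral_diag_real Aherm.
set D := spectral_diag A; set P := spectralmx A => Dreal AE.
pose a i := complex.Re (D 0 i).
have aE i : f (a i) = D 0 i by rewrite /f /= RRe_real.
(* With duplicates removed, the product of the ['X - a] over these eigenvalues has simple roots and
   annihilates [K], so the minimal polynomial divides it. *)
apply/diagonalizableP; exists (undup [seq a i | i <- enum 'I_d.+1]).
  exact: undup_uniq.
apply: mxminpoly_min; apply: (map_mx_inj (f := f)).
rewrite map_mx0 map_horner_mx -/A AE.
rewrite horner_mx_uconjC ?spectral_unit// horner_mx_diag.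
rewrite (_ : diag_mx _ = 0) ?mulmx0 ?mul0mx//.
apply/matrixP => i j; rewrite !mxE -aE horner_map.
rewrite (_ : _.[a i] = 0) ?rmorph0 ?mul0rn//.
apply/eqP; rewrite -/(root _ _) root_prod_XsubC mem_undup.
by apply: map_f; rewrite mem_enum.
Qed.

(** * Bilinearity and definiteness of the dot product *)

Section DotProduct.
Context (R : realType) (d : nat).
Implicit Types (x y z : 'cV[R]_d) (A : 'M[R]_d).

Lemma dotvC x y : dotv x y = dotv y x.
Proof. by rewrite /dotv -[in RHS](trmxK x) -trmx_mul [RHS]mxE. Qed.

Lemma dotvDl x y z : dotv (x + y) z = dotv x z + dotv y z.
Proof. by rewrite /dotv linearD mulmxDl [LHS]mxE. Qed.

Lemma dotvZl a x y : dotv (a *: x) y = a * dotv x y.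
Proof. by rewrite /dotv linearZ -scalemxAl [LHS]mxE. Qed.

Lemma dotvDr x y z : dotv z (x + y) = dotv z x + dotv z y.
Proof. by rewrite !(dotvC z) dotvDl. Qed.

Lemma dotvZr a x y : dotv x (a *: y) = a * dotv x y.
Proof. by rewrite !(dotvC x) dotvZl. Qed.

Lemma dotvBl x y z : dotv (x - y) z = dotv x z - dotv y z.
Proof. by rewrite -scaleN1r dotvDl dotvZl mulN1r. Qed.

Lemma dotvBr x y z : dotv z (x - y) = dotv z x - dotv z y.
Proof. by rewrite !(dotvC z) dotvBl. Qed.

Lemma dotv0r x : dotv x 0 = 0.
Proof. by rewrite /dotv mulmx0 mxE. Qed.

Lemma dotv_sumr n x (F : 'I_n -> 'cV[R]_d) :
  dotv x (\sum_j F j) = \sum_j dotv x (F j).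
Proof. by rewrite /dotv mulmx_sumr summxE. Qed.

Lemma dotv_mulmx A x y : A^T = A -> dotv (A *m x) y = dotv x (A *m y).
Proof. by move=> sA; rewrite /dotv trmx_mul sA mulmxA. Qed.

Lemma sqnormE x : sqnorm x = \sum_i x i 0 ^+ 2.
Proof. by rewrite /sqnorm /dotv mxE; apply: eq_bigr => i _; rewrite mxE. Qed.

Lemma sqnorm_ge0 x : 0 <= sqnorm x.
Proof. by rewrite sqnormE sumr_ge0// => i _; rewrite sqr_ge0. Qed.

Lemma sqnorm_eq0 x : sqnorm x = 0 -> x = 0.
Proof.
rewrite sqnormE => /eqP; rewrite psumr_eq0 => [/allP x0|i _]; last exact: sqr_ge0.
apply/matrixP => i j; rewrite ord1 mxE; apply/eqP.
by have := x0 i (mem_index_enum _); rewrite sqrf_eq0.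
Qed.

End DotProduct.

(** * Binary quadratic forms and minimization of a parabola *)

Section QuadraticForm.
Context (R : realType).
Implicit Types a x y z : R.

(** Source of every Cauchy-Schwarz inequality below. The value of the form at [(z, -y)] is
    [z (a z - y^2)], which settles the case [z > 0]. *)
Lemma discriminant_le a y z :
  (forall s t, 0 <= s ^+ 2 * a + 2 * s * t * y + t ^+ 2 * z) ->
  y ^+ 2 <= a * z.
Proof.
move=> h.
have a0 : 0 <= a by have := h 1 0; lra.
have [z00|z0] := eqVneq z 0.
  (* At [(-y, a + 1)] the form equals [- (a + 2) y^2], which forces [y = 0]. *)
  rewrite z00 mulr0; have := h (- y) (a + 1); rewrite z00 => h1.
  have h2 : (a + 2) * y ^+ 2 <= 0 by lra.
  by rewrite -(pmulr_rle0 _ (_ : 0 < a + 2))//; lra.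
have zp : 0 < z by rewrite lt0r z0/=; have := h 0 1; lra.
have := h z (- y) => h1.
have : 0 <= z * (a * z - y ^+ 2) by lra.
by rewrite pmulr_rge0// subr_ge0.
Qed.

Lemma square_completion_ge0 a x y z : 0 <= x -> 0 <= z -> y ^+ 2 <= x * z ->
  0 <= x - 2 * a * y + a ^+ 2 * z.
Proof.
move=> x0 z0 xz; have [z00|zn0] := eqVneq z 0.
  move: xz; rewrite z00 !mulr0 addr0 => y0.
  have -> : y = 0 by apply/eqP; rewrite -sqrf_eq0 eq_le y0 sqr_ge0.
  by rewrite mulr0 subr0.
have zp : 0 < z by rewrite lt0r zn0.
rewrite -(pmulr_rge0 _ zp).
have -> : z * (x - 2 * a * y + a ^+ 2 * z) = (x * z - y ^+ 2) + (y - a * z) ^+ 2.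
  by ring.
by rewrite addr_ge0 ?sqr_ge0// subr_ge0.
Qed.

Lemma square_completion_eq0 a x y z : 0 <= x -> 0 <= z -> y ^+ 2 <= x * z ->
  x - 2 * a * y + a ^+ 2 * z = 0 -> y = a * z /\ x = a ^+ 2 * z.
Proof.
move=> x0 z0 xz e; have [z00|zn0] := eqVneq z 0.
  move: xz; rewrite z00 !mulr0 => y0.
  have y00 : y = 0 by apply/eqP; rewrite -sqrf_eq0 eq_le y0 sqr_ge0.
  by split=> //; move: e; rewrite y00 z00; lra.
have : (x * z - y ^+ 2) + (y - a * z) ^+ 2 = z * (x - 2 * a * y + a ^+ 2 * z).
  by ring.
rewrite e mulr0 => /eqP; rewrite paddr_eq0 ?sqr_ge0 ?subr_ge0// => /andP[_].
rewrite sqrf_eq0 subr_eq0 => /eqP yE; split=> //.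
by move: e; rewrite yE => e; lra.
Qed.

Lemma le_of_sqr (x y : R) : 0 <= y -> x ^+ 2 <= y ^+ 2 -> x <= y.
Proof. by move=> y0 xy; rewrite leNgt; apply/negP => yx; nra. Qed.

Lemma argmin_quadratic (a b c g : R) : 0 < c -> 0 < a ->
  (forall g', c * (a * g ^+ 2 - 2 * b * g) <= c * (a * g' ^+ 2 - 2 * b * g'))
  <-> g = b / a.
Proof.
move=> c0 a0; have sq (x : R) : a * x ^+ 2 - 2 * b * x
    = a * (x - b / a) ^+ 2 - b ^+ 2 / a by field; rewrite gt_eqF.
split=> [/(_ (b / a))|-> g'].
  rewrite ler_pM2l// !sq subrr expr0n/= mulr0 lerD2r pmulr_rle0// => h.
  by apply/eqP; rewrite -subr_eq0 -sqrf_eq0 eq_le h sqr_ge0.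
rewrite ler_pM2l// !sq subrr expr0n/= mulr0 lerD2r mulr_ge0 ?sqr_ge0//.
exact: ltW.
Qed.

End QuadraticForm.

(** * Spectral resolution of the covariance matrix *)

Section SpectralResolution.
Context (R : realType) (d n : nat) (M : model R d n) (hM : valid_model M).
Implicit Types (j : 'I_n) (X Y : 'cV[R]_d).
Local Notation K := (cov M).
Local Notation P := (eigproj M).
Local Notation ev := (eigval M).

Lemma eigval_inj : injective ev.
Proof.
move=> i j eij; case: (ltngtP i j) => [ij|ij|/val_inj//];
  by have := valid_decreasing hM ij; rewrite eij ltxx.
Qed.

Lemma tr_eigproj j : (P j)^T = P j.
Proof. by case: (valid_proj hM j). Qed.

Lemma eigproj_idem j : P j *m P j = P j.
Proof. by case: (valid_proj hM j). Qed.

Lemma eigproj_cov j : P j *m K = ev j *: P j.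
Proof.
by apply/eigenspaceP; case: (valid_proj hM j) => _ _ /eqmxP ->.
Qed.

Lemma cov_eigproj j : K *m P j = ev j *: P j.
Proof.
rewrite -[LHS]trmxK trmx_mul tr_eigproj (valid_cov hM).1 eigproj_cov.
by rewrite linearZ/= tr_eigproj.
Qed.

Lemma eigproj_orth i j : i != j -> P i *m P j = 0.
Proof.
move=> ij; have : P i *m K *m P j = P i *m (K *m P j) by rewrite mulmxA.
rewrite eigproj_cov cov_eigproj -scalemxAl -scalemxAr => /eqP.
rewrite -subr_eq0 -scalerBl scaler_eq0 subr_eq0 (inj_eq eigval_inj) (negPf ij).
by move=> /eqP.
Qed.

(** By diagonalizability the eigenspaces span everything, and each nonzero one is the row space of
    some [P j]. By orthogonality the sum of the projections acts as the identity on this span. *)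
Lemma sum_eigproj : \sum_j P j = 1%:M.
Proof.
have /diagonalizablePeigen[rs _ rs1] := diagonalizable_symmetric (valid_cov hM).1.
have : (1%:M <= \sum_j P j)%MS.
  rewrite -rs1; elim/big_rec : _ => [|r S _ IH]; first exact: sub0mx.
  rewrite addsmx_sub IH andbT.
  have [/(valid_spectrum hM)[j ->]|] := boolP (eigenvalue K r).
    by rewrite (sumsmx_sup j)//; case: (valid_proj hM j) => _ _ /eqmxP ->.
  by rewrite /eigenvalue negbK => /eqP ->; exact: sub0mx.
move=> /sub_sumsmxP[B B1].
rewrite -[LHS]mul1mx B1 mulmx_suml; apply: eq_bigr => j _.
rewrite -mulmxA mulmx_sumr (bigD1 j)//= eigproj_idem big1 ?addr0// => i ij.
by rewrite eigproj_orth// eq_sym.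
Qed.

Lemma cov_spectral : K = \sum_j ev j *: P j.
Proof.
rewrite -[LHS]mulmx1 -sum_eigproj mulmx_sumr.
by apply: eq_bigr => j _; rewrite cov_eigproj.
Qed.

Lemma dotv_eigproj j X Y : dotv (P j *m X) (P j *m Y) = dotv X (P j *m Y).
Proof. by rewrite dotv_mulmx ?tr_eigproj// mulmxA eigproj_idem. Qed.

Lemma sum_sqnorm_eigproj X : \sum_j sqnorm (P j *m X) = sqnorm X.
Proof.
under eq_bigr do rewrite /sqnorm dotv_eigproj.
by rewrite -dotv_sumr -mulmx_suml sum_eigproj mul1mx.
Qed.

Lemma dotv_cov X : dotv X (K *m X) = \sum_j ev j * sqnorm (P j *m X).
Proof.
rewrite cov_spectral mulmx_suml dotv_sumr; apply: eq_bigr => j _.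
by rewrite /sqnorm dotv_eigproj -scalemxAl dotvZr.
Qed.

Lemma eigval_ge0 j : 0 <= ev j.
Proof.
have /(valid_spectrum hM)/eigenvalueP[u uK u0] : exists i, ev j = ev i by exists j.
have un : 0 < sqnorm u^T.
  rewrite lt0r sqnorm_ge0 andbT; apply: contra u0 => /eqP/sqnorm_eq0 u0.
  by rewrite -[u]trmxK u0 trmx0.
have := (valid_cov hM).2 u^T.
rewrite -[K in K *m _]((valid_cov hM).1) -trmx_mul uK linearZ/= dotvZr.
by rewrite pmulr_lge0.
Qed.

Lemma eigproj_sum (a : 'I_n -> R) j X :
  P j *m (\sum_i a i *: (P i *m X)) = a j *: (P j *m X).
Proof.
rewrite mulmx_sumr (bigD1 j)//= -scalemxAr mulmxA eigproj_idem.
rewrite big1 ?addr0// => i ij.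
by rewrite -scalemxAr mulmxA eigproj_orth ?mul0mx ?scaler0// eq_sym.
Qed.

Lemma mult_gt0 j : (0 < mult M j)%N.
Proof.
have /(valid_spectrum hM) : exists i, ev j = ev i by exists j.
rewrite eigenvalue_root_char => e.
by rewrite -XsubC_dvd ?dvdp_XsubCl// monic_neq0// char_poly_monic.
Qed.

Lemma exists_eigval_gt0 : K != 0 -> exists j, 0 < ev j.
Proof.
move=> K0; apply/existsP; apply: contra_neqT K0; rewrite negb_exists => /forallP h.
rewrite cov_spectral big1// => j _; have := h j.
by rewrite lt0r eigval_ge0 andbT negbK => /eqP ->; rewrite scale0r.
Qed.

(** With a single eigenvalue [K] is a scalar matrix, whose characteristic polynomial is a [d]-th
    power of a linear factor. *)
Lemma mult_single j : n = 1%N -> mult M j = d.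
Proof.
move=> n1; rewrite /mult (_ : K = (ev j)%:M).
  rewrite char_poly_trig ?scalar_mx_is_trig//.
  under eq_bigr do rewrite mxE eqxx mulr1n.
  by rewrite prodr_const card_ord mup_XsubCX eqxx.
rewrite cov_spectral.
rewrite -scalemx1 -sum_eigproj scaler_sumr; apply: eq_bigr => i _.
congr (ev _ *: _); apply: ord_inj.
by apply/eqP; rewrite eqn_leq; move: (ltn_ord i) (ltn_ord j); lia.
Qed.

End SpectralResolution.

(** * Ridge objective, eigenspace by eigenspace *)

Section RidgeDecomposition.
Context (R : realType) (d n : nat) (M : model R d n) (hM : valid_model M).
Implicit Types (j : 'I_n) (X Y : 'cV[R]_d) (v : state R n) (l : R).
Local Notation K := (cov M).
Local Notation P := (eigproj M).
Local Notation ev := (eigval M).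
Local Notation Xs := (target M).

(** Keeping [l] free allows statements about a fixed ridge problem; at [l = lambda_eff M v] this is
    [excess_part] by conversion. *)
Definition ridge_part l v j : R :=
  2^-1 * ((ev j + l) * V11 v j - 2 * ev j * V12 v j + ev j ^+ 2 / (ev j + l) * V22 M j).

(** This is [(K + l I)^-1 K X^*], written through the spectral resolution. *)
Definition ridge_minimizer l : 'cV[R]_d :=
  \sum_j (ev j / (ev j + l)) *: (P j *m Xs).

(* [V12 ^ 2 <= V11 * V22] is the Cauchy-Schwarz inequality between [P_j X] and [P_j X^*]. *)
Definition admissible v : Prop :=
  forall j, 0 <= V11 v j /\ V12 v j ^+ 2 <= V11 v j * V22 M j.

Lemma V22_ge0 j : 0 <= V22 M j.
Proof. exact: sqnorm_ge0. Qed.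

Lemma sqnorm_residual j X :
  sqnorm (P j *m (X - Xs)) =
  V11 (state_of M X) j - 2 * V12 (state_of M X) j + V22 M j.
Proof.
rewrite /= /V22 /sqnorm !(dotv_eigproj hM) mulmxBr dotvBl !dotvBr.
have -> : dotv Xs (P j *m X) = dotv X (P j *m Xs).
  by rewrite dotvC dotv_mulmx ?(tr_eigproj hM).
by ring.
Qed.

Lemma risk_state_of X :
  risk M (state_of M X) = 2^-1 * dotv (X - Xs) (K *m (X - Xs)) + noise M ^+ 2 / 2.
Proof.
rewrite /risk (dotv_cov hM); congr (_ * _ + _).
by apply: eq_bigr => j _; rewrite sqnorm_residual.
Qed.

Lemma B44_state_of X : B44 (state_of M X) = sqnorm X.
Proof. exact: sum_sqnorm_eigproj. Qed.

Lemma Phi_state_of l X : Phi M l (state_of M X) = ridge_objective M l X.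
Proof. by rewrite /Phi risk_state_of B44_state_of. Qed.

Lemma admissible_state_of X : admissible (state_of M X).
Proof.
move=> j; split=> /=; first exact: sqnorm_ge0.
apply: discriminant_le => s t.
have -> : s ^+ 2 * sqnorm (P j *m X) + 2 * s * t * dotv X (P j *m Xs)
    + t ^+ 2 * V22 M j = sqnorm (P j *m (s *: X + t *: Xs)).
  rewrite /V22 /sqnorm !(dotv_eigproj hM) mulmxDr dotvDl !dotvDr.
  rewrite -!scalemxAr !dotvZl !dotvZr.
  have -> : dotv Xs (P j *m X) = dotv X (P j *m Xs).
    by rewrite dotvC dotv_mulmx ?(tr_eigproj hM).
  by ring.
exact: sqnorm_ge0.
Qed.

Lemma eigval_ridge_gt0 l j : 0 < l -> 0 < ev j + l.
Proof. by move=> l0; rewrite ltr_wpDl// (eigval_ge0 hM). Qed.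

(** On each eigenspace [lambda - lambda^2 / (lambda + l) = lambda l / (lambda + l)]. Zero
    eigenvalues contribute nothing to [Phi_min], so its restriction to positive ones is harmless. *)
Lemma Phi_decomposition l v : 0 < l ->
  Phi M l v = Phi_min M l + \sum_j ridge_part l v j.
Proof.
move=> l0; rewrite /Phi /Phi_min /risk /B44 !mulr_sumr.
rewrite [LHS]addrAC [RHS]addrAC -big_split/=; congr (_ + _).
rewrite [X in _ = X + _]big_mkcond -big_split/=.
apply: eq_bigr => j _; rewrite /ridge_part.
have lj := eigval_ridge_gt0 j l0.
case: ifPn => [_|]; first by field; rewrite gt_eqF.
rewrite -leNgt => ej0; have -> : ev j = 0 by apply/eqP; rewrite eq_le ej0 (eigval_ge0 hM).
by field; rewrite gt_eqF.
Qed.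

Lemma ridge_partE l v j : 0 < l ->
  let a := ev j / (ev j + l) in
  ridge_part l v j =
  2^-1 * (ev j + l) * (V11 v j - 2 * a * V12 v j + a ^+ 2 * V22 M j).
Proof.
move=> l0 a; rewrite /ridge_part /a; field.
by rewrite gt_eqF// eigval_ridge_gt0.
Qed.

Lemma ridge_part_ge0 l v j : 0 < l -> admissible v -> 0 <= ridge_part l v j.
Proof.
move=> l0 /(_ j)[v0 vj]; rewrite ridge_partE//.
have lj := eigval_ridge_gt0 j l0.
apply: mulr_ge0; first by rewrite mulr_ge0 ?invr_ge0 ?ltW.
by apply: square_completion_ge0 => //; exact: V22_ge0.
Qed.

Lemma Phi_min_le l X : 0 < l -> Phi_min M l <= ridge_objective M l X.
Proof.
move=> l0; rewrite -Phi_state_of Phi_decomposition// lerDl sumr_ge0// => j _.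
exact/ridge_part_ge0/admissible_state_of.
Qed.

Lemma V11_ridge_minimizer l j :
  V11 (state_of M (ridge_minimizer l)) j = (ev j / (ev j + l)) ^+ 2 * V22 M j.
Proof.
by rewrite /= /ridge_minimizer (eigproj_sum hM) /V22 /sqnorm dotvZl dotvZr mulrA.
Qed.

Lemma V12_ridge_minimizer l j :
  V12 (state_of M (ridge_minimizer l)) j = ev j / (ev j + l) * V22 M j.
Proof.
by rewrite /= -(dotv_eigproj hM) /ridge_minimizer (eigproj_sum hM) /V22 /sqnorm dotvZl.
Qed.

Lemma ridge_minimizerP l : 0 < l ->
  ridge_objective M l (ridge_minimizer l) = Phi_min M l.
Proof.
move=> l0; rewrite -Phi_state_of Phi_decomposition// big1 ?addr0// => j _.
by rewrite ridge_partE// V11_ridge_minimizer V12_ridge_minimizer; ring.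
Qed.

(** Every nonnegative summand vanishes, and the equality case of the completed square determines
    both [V12] and [V11]. *)
Lemma state_ridge_minimizer l v : 0 < l -> admissible v ->
  \sum_j ridge_part l v j = 0 -> v = state_of M (ridge_minimizer l).
Proof.
move=> l0 hv /eqP; rewrite psumr_eq0 => [/allP h|j _]; last exact: ridge_part_ge0.
have hj j : V12 v j = ev j / (ev j + l) * V22 M j /\
    V11 v j = (ev j / (ev j + l)) ^+ 2 * V22 M j.
  have [v0 vj] := hv j.
  apply: square_completion_eq0 => //; first exact: V22_ge0.
  have := h j (mem_index_enum _); rewrite ridge_partE// => /eqP/eqP.
  rewrite -mulrA !mulf_eq0 invr_eq0 pnatr_eq0/= gt_eqF ?eigval_ridge_gt0//=.
  by move=> /eqP.
case: v hj {hv h} => w11 w12 /= hj.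
rewrite -[RHS]/(State (V11 (state_of M (ridge_minimizer l)))
                      (V12 (state_of M (ridge_minimizer l)))).
congr State; apply/funext => j; have [h2 h1] := hj j.
  by rewrite V11_ridge_minimizer.
by rewrite V12_ridge_minimizer.
Qed.

End RidgeDecomposition.

(** * Differentiation rules along a general filter *)

Section DifferenceQuotient.
Context (R : realType) (F : set_system R) {FF : ProperFilter F}.
Hypothesis F0 : h @[h --> F] --> (0 : R).
Hypothesis Fneq0 : \forall h \near F, h != 0.
Implicit Types (f g : R -> R) (a b x y : R).

(* [F] is [0^'] for the two-sided derivative and [0^'+] for the right one. *)
Definition quotient_cvg f a x : Prop := h^-1 * (f h - a) @[h --> F] --> x.

Lemma quotient_cvg_cvg f a x : quotient_cvg f a x -> f h @[h --> F] --> a.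
Proof.
move=> fx; have : a + h * (h^-1 * (f h - a)) @[h --> F] --> a + 0 * x.
  by apply: cvgD; [exact: cvg_cst|exact: cvgM].
rewrite mul0r addr0; apply: cvg_trans; apply: near_eq_cvg.
near=> h; have h0 : h != 0 by near: h.
by rewrite mulVKf// addrC subrK.
Unshelve. all: by end_near. Qed.

Lemma quotient_cvgD f g a b x y : quotient_cvg f a x -> quotient_cvg g b y ->
  quotient_cvg (fun h => f h + g h) (a + b) (x + y).
Proof.
move=> fx gy; rewrite /quotient_cvg.
under eq_fun do rewrite opprD addrACA mulrDr.
exact: cvgD.
Qed.

Lemma quotient_cvgZ c f a x : quotient_cvg f a x ->
  quotient_cvg (fun h => c * f h) (c * a) (c * x).
Proof.
move=> fx; rewrite /quotient_cvg.
under eq_fun do rewrite -mulrBr mulrCA.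
by apply: cvgM fx; exact: cvg_cst.
Qed.

Lemma quotient_cvgN f a x : quotient_cvg f a x ->
  quotient_cvg (fun h => - f h) (- a) (- x).
Proof.
move=> fx; rewrite /quotient_cvg.
by under eq_fun do rewrite -opprD mulrN; exact: cvgN.
Qed.

Lemma quotient_cvg_cst a : quotient_cvg (fun=> a) a 0.
Proof.
rewrite /quotient_cvg; under eq_fun do rewrite subrr mulr0.
exact: cvg_cst.
Qed.

Lemma quotient_cvgM f g a b x y : quotient_cvg f a x -> quotient_cvg g b y ->
  quotient_cvg (fun h => f h * g h) (a * b) (x * b + a * y).
Proof.
move=> fx gy; rewrite /quotient_cvg.
have e h : h^-1 * (f h * g h - a * b) =
  (h^-1 * (f h - a)) * g h + a * (h^-1 * (g h - b)) by ring.
under eq_fun do rewrite e.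
apply: cvgD; first exact: (cvgM fx (quotient_cvg_cvg gy)).
by apply: cvgM gy; exact: cvg_cst.
Qed.

Lemma quotient_cvg_sum n (f : 'I_n -> R -> R) (a x : 'I_n -> R) :
  (forall j, quotient_cvg (f j) (a j) (x j)) ->
  quotient_cvg (fun h => \sum_j f j h) (\sum_j a j) (\sum_j x j).
Proof.
move=> fx; rewrite /quotient_cvg.
under eq_fun do rewrite -sumrB mulr_sumr.
apply: cvg_big => [z|j _]; last exact: fx.
by apply: cvgD; [exact: cvg_fst|exact: cvg_snd].
Qed.

(** Multiplication by the conjugate [sqrt (f h) + sqrt a], which stays away from 0 since [a > 0]. *)
Lemma quotient_cvg_sqrt f a x : 0 < a -> quotient_cvg f a x ->
  quotient_cvg (fun h => Num.sqrt (f h)) (Num.sqrt a) (x / (2 * Num.sqrt a)).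
Proof.
move=> a0 fx; have fa := quotient_cvg_cvg fx.
have sa0 : 0 < Num.sqrt a by rewrite sqrtr_gt0.
have : (h^-1 * (f h - a)) * (Num.sqrt (f h) + Num.sqrt a)^-1 @[h --> F]
    --> x * (Num.sqrt a + Num.sqrt a)^-1.
  apply: (cvgM fx); apply: cvgV; first by rewrite gt_eqF ?addr_gt0.
  apply: cvgD; last exact: cvg_cst.
  by apply: continuous_cvg fa; exact: sqrt_continuous.
rewrite -mulr2n -[_ *+ 2]mulr_natl; apply: cvg_trans; apply: near_eq_cvg.
near=> h; have fh : 0 < f h by near: h; exact: cvgr_gt fa _ a0.
rewrite -mulrA; congr (_ * _).
have e : f h - a = (Num.sqrt (f h) - Num.sqrt a) * (Num.sqrt (f h) + Num.sqrt a).
  by rewrite -subr_sqr !sqr_sqrtr ?ltW.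
by rewrite e mulfK// gt_eqF// ltr_pwDl// sqrtr_gt0.
Unshelve. all: by end_near. Qed.

End DifferenceQuotient.

(** * First-order comparison of the adversarial risk with the ridge objective *)

Section AdversarialRiskRate.
Context (R : realType) (d n : nat) (M : model R d n).
Implicit Types (j : 'I_n) (v w : state R n).
Local Notation ev := (eigval M).
Local Notation le := (lambda_eff M).
Local Notation k := (Defs.radius M * Num.sqrt (2 / pi)).

(** The ratio of effective to actual learning rate, and the factor relating the adversarial risk to
    [Phi]. *)
Definition slope v : R := 1 + k * Defs.q M v.

Lemma radius_coef_gt0 : valid_model M -> 0 < k.
Proof.
by move=> hM; rewrite mulr_gt0 ?(valid_radius hM)// sqrtr_gt0 divr_gt0// pi_gt0.
Qed.

Lemma q_gt0 v : 0 < risk M v -> 0 < B44 v -> 0 < Defs.q M v.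
Proof. by move=> r0 b0; rewrite sqrtr_gt0 divr_gt0// mulr_gt0. Qed.

Lemma slope_gt0 v : valid_model M -> 0 < risk M v -> 0 < B44 v -> 0 < slope v.
Proof.
move=> hM r0 b0; rewrite addr_gt0// mulr_gt0 ?radius_coef_gt0//; exact: q_gt0.
Qed.

Lemma slope_lambda_eff v : valid_model M -> 0 < risk M v -> 0 < B44 v ->
  slope v * le v = Defs.radius M ^+ 2 + k * (Defs.q M v)^-1.
Proof.
move=> hM r0 b0; rewrite /lambda_eff -/(slope v) mulrC divfK//.
by rewrite gt_eqF// slope_gt0.
Qed.

Lemma lambda_eff_gt0 v : valid_model M -> 0 < risk M v -> 0 < B44 v -> 0 < le v.
Proof.
move=> hM r0 b0; rewrite divr_gt0//; last exact: slope_gt0.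
rewrite addr_gt0 ?exprn_gt0 ?(valid_radius hM)//.
by rewrite mulr_gt0 ?radius_coef_gt0// invr_gt0 q_gt0.
Qed.

(* With [r = sqrt (2 R)] and [b = sqrt B], the risk is
   [R^Adv = r^2 / 2 + k r b + delta^2 b^2 / 2] and [q = b / r]. *)
Lemma sqrt_coordinates v : 0 < risk M v -> 0 < B44 v ->
  exists r b : R, [/\ 0 < r, 0 < b, risk M v = r ^+ 2 / 2, B44 v = b ^+ 2 &
    Defs.q M v = b / r /\ Num.sqrt (2 * B44 v * risk M v) = b * r].
Proof.
move=> r0 b0; exists (Num.sqrt (2 * risk M v)), (Num.sqrt (B44 v)).
rewrite !sqrtr_gt0 !sqr_sqrtr ?ltW ?mulr_gt0//; split=> //; first by field.
rewrite /Defs.q sqrtrM ?ltW// sqrtrV ?mulr_ge0 ?ltW//; split=> //.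
by rewrite -sqrtrM ?ltW//; congr Num.sqrt; ring.
Qed.

(** The cross term [k r b] arises in two halves: [k q] times [R], and [k / q] times [B / 2]. *)
Lemma adv_risk_Phi v : valid_model M -> 0 < risk M v -> 0 < B44 v ->
  adv_risk M v = slope v * Phi M (le v) v.
Proof.
move=> hM r0 b0; rewrite /Phi mulrDr mulrA [_ * (_ / 2)]mulrA slope_lambda_eff//.
have [r [b [r1 b1 rE bE [qE sE]]]] := sqrt_coordinates r0 b0.
by rewrite /adv_risk /slope sE qE rE bE; field; rewrite !gt_eqF.
Qed.

(** The differential of [Phi] in direction [w], with the ridge parameter frozen at its value at
    [v]. *)
Definition Phi_gradient v w : R :=
  \sum_j (2^-1 * (ev j + le v) * V11 w j - ev j * V12 w j).

(** A general filter and curve cover both the straight line that defines [adv_risk_rate] and the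
    trajectory itself, where only right derivatives exist. The chain rule gives
    [(1 + k q) dR + (delta^2 + k / q) dB / 2], whose coefficients are [slope] and
    [slope * lambda_eff / 2]. *)
Lemma adv_risk_quotient (F : set_system R) {FF : ProperFilter F}
    (W : R -> state R n) v w :
  h @[h --> F] --> (0 : R) -> (\forall h \near F, h != 0) ->
  valid_model M -> 0 < risk M v -> 0 < B44 v ->
  (forall j, quotient_cvg F (fun h => V11 (W h) j) (V11 v j) (V11 w j)) ->
  (forall j, quotient_cvg F (fun h => V12 (W h) j) (V12 v j) (V12 w j)) ->
  quotient_cvg F (fun h => adv_risk M (W h)) (adv_risk M v)
    (slope v * Phi_gradient v w).
Proof.
move=> F0 Fn0 hM r0 b0 W11 W12.
have Bq : quotient_cvg F (fun h => B44 (W h)) (B44 v) (\sum_j V11 w j).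
  exact: quotient_cvg_sum.
pose dR := 2^-1 * \sum_j ev j * (V11 w j - 2 * V12 w j).
have Rq : quotient_cvg F (fun h => risk M (W h)) (risk M v) dR.
  rewrite /risk /dR -[X in quotient_cvg _ _ _ X]addr0.
  apply: quotient_cvgD; last exact: quotient_cvg_cst.
  apply: quotient_cvgZ; apply: quotient_cvg_sum => j; apply: quotient_cvgZ.
  rewrite -[X in quotient_cvg _ _ _ X]addr0.
  apply: quotient_cvgD; last exact: quotient_cvg_cst.
  apply: quotient_cvgD => //.
  by apply: quotient_cvgN; exact: quotient_cvgZ.
have s0 : 0 < 2 * B44 v * risk M v by rewrite !mulr_gt0.
have Sq : quotient_cvg F (fun h => Num.sqrt (2 * B44 (W h) * risk M (W h)))
    (Num.sqrt (2 * B44 v * risk M v))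
    ((2 * (\sum_j V11 w j) * risk M v + 2 * B44 v * dR)
     / (2 * Num.sqrt (2 * B44 v * risk M v))).
  apply: quotient_cvg_sqrt => //; apply: quotient_cvgM => //.
  exact: quotient_cvgZ.
rewrite (_ : slope v * _ = dR + k * ((2 * (\sum_j V11 w j) * risk M v + 2 * B44 v * dR)
    / (2 * Num.sqrt (2 * B44 v * risk M v))) + Defs.radius M ^+ 2 / 2 * \sum_j V11 w j).
  by apply: quotient_cvgD; [apply: quotient_cvgD => //; exact: quotient_cvgZ|
    exact: quotient_cvgZ].
have -> : Phi_gradient v w = dR + le v / 2 * \sum_j V11 w j.
  rewrite /Phi_gradient /dR !mulr_sumr -big_split/=; apply: eq_bigr => j _.
  by field.
rewrite mulrDr mulrA [_ * (_ / 2)]mulrA slope_lambda_eff//.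
have [r [b [r1 b1 rE bE [qE sE]]]] := sqrt_coordinates r0 b0.
by rewrite sE /slope qE rE bE; field; rewrite !gt_eqF.
Qed.

Lemma adv_risk_rateE v g : valid_model M -> 0 < risk M v -> 0 < B44 v ->
  adv_risk_rate M v g = slope v * Phi_gradient v (drift M v g).
Proof.
move=> hM r0 b0; rewrite /adv_risk_rate /derive1; apply: cvg_lim => //.
have line (a x : R) : quotient_cvg 0^' (fun h => a + h * x) a x.
  apply: cvg_near_cst; near=> h.
  have h0 : h != 0 by near: h; exact: nbhs_dnbhs_neq.
  by rewrite addrC addKr mulKf.
have F0 : h @[h --> 0^'] --> (0 : R) by exact: cvg_within.
have Fn0 : \forall h \near (0 : R)^', h != 0 by exact: nbhs_dnbhs_neq.
pose W h := State (fun j => V11 v j + h * V11 (drift M v g) j)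
  (fun j => V12 v j + h * V12 (drift M v g) j).
have W0 : W 0 = v.
  rewrite /W; case: (v) => w1 w2 /=; congr State; apply/funext => j;
  by rewrite mul0r addr0.
under eq_fun => h do rewrite addr0.
have qc : quotient_cvg 0^' (fun h => adv_risk M (W h)) (adv_risk M (W 0))
    (slope v * Phi_gradient v (drift M v g)).
  by rewrite W0; apply: (@adv_risk_quotient _ _ W) => // j; exact: line.
exact: qc.
Unshelve. all: by end_near. Qed.

End AdversarialRiskRate.

(** * Propagation of nonnegativity by differential inequalities *)

Section Barrier.
Context (R : realType).
Implicit Types (f : R -> R) (s t u C : R).

Lemma within_itv_lt0 f t s : {within `[0, t], continuous f} -> 0 <= s <= t ->
  f s < 0 -> exists2 e, 0 < e & forall u, 0 <= u <= t -> `|s - u| < e -> f u < 0.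
Proof.
move=> /subspace_continuousP cf st fs.
have /cf fc : `[0, t]%classic s by rewrite /= in_itv.
have [e /= e0 he] := (nbhs_ballP s [set u | `[0, t]%classic u -> f u < 0]).1
  (cvgr_lt _ fc _ fs).
by exists e => // u ut su; apply: he => //=; rewrite in_itv.
Qed.

(* Continuous induction: the set of [s] with [0 <= f] on [[0, s]] is closed and,
   by the condition on the zeros of [f], cannot stop before [t]. *)
Lemma barrier f t : 0 <= t -> {within `[0, t], continuous f} -> 0 <= f 0 ->
  (forall s, 0 <= s < t -> f s = 0 -> exists2 l, 0 < l & right_derivative f s l) ->
  0 <= f t.
Proof.
move=> t0 cf f0 fz.
pose E := [set s | 0 <= s <= t /\ forall u, 0 <= u <= s -> 0 <= f u].
have E0 : E 0.
  split; first by rewrite lexx.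
  by move=> u /andP[u0 u1]; have -> : u = 0 by apply/eqP; rewrite eq_le u0 u1.
have Eub : ubound E t by move=> s [/andP[]].
have hE : has_sup E by split; [exists 0|exists t].
pose S := sup E.
have S0 : 0 <= S by apply: ub_le_sup => //; exact: hE.2.
have St : S <= t by apply: ge_sup => //; exists 0.
have fS u : 0 <= u <= S -> 0 <= f u.
  move=> /andP[u0]; rewrite le_eqVlt => /predU1P[->|uS]; last first.
    have uS0 : 0 < S - u by rewrite subr_gt0.
    have [s [_ hs]] := sup_adherent uS0 hE.
    by rewrite -/S subKr => us; apply: hs; rewrite u0 ltW.
  rewrite leNgt; apply/negP => fS0.
  have [|e e0 he] := within_itv_lt0 cf _ fS0; first by rewrite S0 St.
  have [s [/andP[s0 st] hs] Ss] := sup_adherent e0 hE.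
  have sS : s <= S by apply: ub_le_sup; [exact: hE.2|split=> //; rewrite s0].
  have : f s < 0 by apply: he; rewrite ?s0// ger0_norm ?subr_ge0//; move: Ss; rewrite -/S; lra.
  by rewrite ltNge hs// lexx s0.
have [->|St1] := eqVneq t S; first by apply: fS; rewrite S0 lexx.
have {St1}St1 : S < t by rewrite lt_neqAle eq_sym St1.
(* Extending nonnegativity by any [e] beyond [S] contradicts the choice of [S] as supremum. *)
suff [e e0 he] : exists2 e, 0 < e & forall u, S < u <= t -> u - S < e -> 0 <= f u.
  pose s := Num.min t (S + e / 2).
  have Ss : S < s by rewrite lt_min St1 ltrDl divr_gt0.
  suff : s <= S by rewrite leNgt Ss.
  apply: ub_le_sup; first exact: hE.2.
  have s0 : 0 <= s by exact: le_trans S0 (ltW Ss).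
  split; first by rewrite s0 ge_min lexx.
  move=> u /andP[u0 us]; have [uS|Su] := leP u S; first by apply: fS; rewrite u0.
  have [ut ue] : u <= t /\ u <= S + e / 2.
    by move: us; rewrite le_min => /andP[].
  by apply: he; rewrite ?Su//; lra.
(* If [f S = 0] the positive right derivative lifts [f] just after [S]; if [f S > 0] continuity
   suffices. *)
have := fS S; rewrite S0 lexx => /(_ isT); rewrite le_eqVlt => /predU1P[/esym fS0|fS0].
  have [|l l0 fl] := fz S _ fS0; first by rewrite S0.
  have [e /= e0 he] := (nbhs_ballP (0 : R)
    [set k | 0 < k -> 0 < k^-1 * (f (S + k) - f S)]).1 (cvgr_gt _ fl _ l0).
  exists e => // u /andP[Su ut] ue.
  have : 0 < (u - S)^-1 * (f (S + (u - S)) - f S).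
    apply: he => /=; last by rewrite subr_gt0.
    by rewrite /ball/= sub0r normrN ger0_norm// subr_ge0 ltW.
  by rewrite fS0 subr0 addrCA subrr addr0 pmulr_rgt0 ?invr_gt0 ?subr_gt0// => /ltW.
have cNf : {within `[0, t], continuous (fun u => - f u)}.
  by move=> u; apply: cvgN; exact: cf.
have [||e e0 he] := within_itv_lt0 (s := S) cNf; rewrite ?S0 ?oppr_lt0//.
exists e => // u /andP[Su ut] ue; rewrite ltW// -oppr_lt0; apply: he.
  by rewrite ut andbT ltW// (le_lt_trans S0).
by rewrite distrC ger0_norm// subr_ge0 ltW.
Qed.

Lemma right_derivative_expR C s :
  right_derivative (fun u => expR (C * u)) s (C * expR (C * s)).
Proof.
have : is_derive s 1 (expR \o ( *%R C)) (expR (C * s) * (C *: 1)).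
  apply: is_derive1_comp.
rewrite /GRing.scale/= mulr1 mulrC => -[/cvg_ex[/= l sl]].
rewrite /derive (cvg_lim _ sl)// => <-.
apply: cvg_dnbhs_at_right; apply: cvg_trans sl; apply: near_eq_cvg.
by near=> h; rewrite [h%:A]mulr1 (addrC s).
Unshelve. all: by end_near. Qed.

(** The perturbation [g = f + e exp (k s)] meets the barrier condition: at a zero of [g] the right
    derivative is at least [(k - C) e exp (k s)], which is positive because [k = C + 1]. *)
Lemma gronwall_ge0 f t C : 0 <= t -> {within `[0, t], continuous f} -> 0 <= f 0 ->
  (forall s, 0 <= s < t -> exists a b,
    [/\ `|a| <= C, 0 <= b & right_derivative f s (a * f s + b)]) ->
  0 <= f t.
Proof.
move=> t0 cf f0 fd; rewrite leNgt; apply/negP => ft.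
pose k := C + 1.
(* This size makes [g t = f t / 2], still negative, which contradicts the barrier. *)
pose e := - f t / (2 * expR (k * t)).
have e0 : 0 < e by rewrite divr_gt0 ?oppr_gt0// mulr_gt0 ?expR_gt0.
pose g s := f s + e * expR (k * s).
suff : 0 <= g t.
  have -> : g t = f t / 2 by rewrite /g /e; field; rewrite gt_eqF ?expR_gt0.
  by lra.
apply: barrier => //.
- move=> u; apply: cvgD; first exact: cf.
  apply: cvgM; first exact: cvg_cst.
  have : {within `[0, t], continuous (fun u => expR (k * u))}.
    apply: continuous_subspaceT => x.
    apply: continuous_comp; last exact: continuous_expR.
    by apply: cvgM; [exact: cvg_cst|exact: cvg_id].
  exact.
- by rewrite /g addr_ge0// mulr_ge0 ?expR_ge0 ?ltW.
move=> s st gs0; have [a [b [aC b0 fs]]] := fd s st.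
have es0 : 0 < e * expR (k * s) by rewrite mulr_gt0 ?expR_gt0.
exists (a * f s + b + e * (k * expR (k * s))).
  have -> : f s = - (e * expR (k * s)) by apply/eqP; rewrite -addr_eq0; apply/eqP.
  have := ler_norm a; rewrite /k; nra.
apply: quotient_cvgD => //; apply: quotient_cvgZ; exact: right_derivative_expR.
Qed.

End Barrier.

(** * Invariance of admissibility under the dynamics *)

Section Invariance.
Context (R : realType) (d n : nat) (M : model R d n) (hM : valid_model M).
Context (X0 : 'cV[R]_d) (gamma : R -> R) (T : \bar R) (V : R -> state R n).
Context (hV : sgd_limit M X0 gamma T V).
Implicit Types (j : 'I_n) (v w : state R n) (s t : R).
Local Notation ev := (eigval M).
Local Notation le := (lambda_eff M).

Lemma before_end s t : 0 <= s <= t -> (t%:E < T)%E -> 0 <= s /\ (s%:E < T)%E.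
Proof. by move=> /andP[s0 st] tT; split=> //; rewrite (le_lt_trans _ tT)// lee_fin. Qed.

Lemma within_V11 t j : (t%:E < T)%E -> {within `[0, t], continuous (fun s => V11 (V s) j)}.
Proof.
move=> tT; have := @sgd_cont11 _ _ _ _ _ _ _ _ hV j; apply: continuous_subspaceW => s /=.
by rewrite in_itv/= => st; exact: before_end st tT.
Qed.

Lemma within_V12 t j : (t%:E < T)%E -> {within `[0, t], continuous (fun s => V12 (V s) j)}.
Proof.
move=> tT; have := @sgd_cont12 _ _ _ _ _ _ _ _ hV j; apply: continuous_subspaceW => s /=.
by rewrite in_itv/= => st; exact: before_end st tT.
Qed.

(** A continuous function on a compact interval is bounded. The form [f] of the rate avoids the
    quotient in [lambda_eff]; positivity of the risk and of [B44] gives continuity of [q] and its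
    inverse. *)
Lemma contraction_rate_bound t j : 0 <= t -> (t%:E < T)%E ->
  exists C : R, forall s, 0 <= s <= t -> `|slope M (V s) * (ev j + le (V s))| <= C.
Proof.
move=> t0 tT.
pose k := Defs.radius M * Num.sqrt (2 / pi).
pose f s := slope M (V s) * ev j + (Defs.radius M ^+ 2 + k * (Defs.q M (V s))^-1).
have cf : {within `[0, t], continuous f}.
  apply/subspace_continuousP => s st; move: (st); rewrite /= in_itv/= => sT.
  have [s0 {}sT] := before_end sT tT.
  have [r0 b0] := sgd_risk hV s0 sT.
  have c11 i := (subspace_continuousP _ _).1 (@within_V11 t i tT) s st.
  have c12 i := (subspace_continuousP _ _).1 (@within_V12 t i tT) s st.
  have cB : B44 (V u) @[u --> within `[0, t] (nbhs s)] --> B44 (V s).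
    apply: cvg_big => [z|i _]; last exact: c11.
    by apply: cvgD; [exact: cvg_fst|exact: cvg_snd].
  have cR : risk M (V u) @[u --> within `[0, t] (nbhs s)] --> risk M (V s).
    apply: cvgD; last exact: cvg_cst.
    apply: cvgM; first exact: cvg_cst.
    apply: cvg_big => [z|i _].
      by apply: cvgD; [exact: cvg_fst|exact: cvg_snd].
    apply: cvgM; first exact: cvg_cst.
    apply: cvgD; last exact: cvg_cst.
    apply: cvgB; first exact: c11.
    by apply: cvgM; [exact: cvg_cst|exact: c12].
  have cq : Defs.q M (V u) @[u --> within `[0, t] (nbhs s)] --> Defs.q M (V s).
    apply: continuous_cvg; first exact: sqrt_continuous.
    apply: (cvgM cB); apply: cvgV; first by rewrite gt_eqF// mulr_gt0.
    by apply: cvgM cR; exact: cvg_cst.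
  apply: cvgD.
    apply: cvgM; last exact: cvg_cst.
    apply: cvgD; first exact: cvg_cst.
    by apply: cvgM cq; exact: cvg_cst.
  apply: cvgD; first exact: cvg_cst.
  apply: cvgM; first exact: cvg_cst.
  by apply: cvgV cq; rewrite gt_eqF// q_gt0.
have [c _ hc] := EVT_max t0 cf.
exists (f c) => s st; have [s0 sT] := before_end st tT.
have [r0 b0] := sgd_risk hV s0 sT.
rewrite ger0_norm; last first.
  rewrite mulr_ge0 ?ltW ?slope_gt0// ?(eigval_ridge_gt0 hM)//.
  exact: lambda_eff_gt0.
by rewrite mulrDr slope_lambda_eff//; apply: hc; rewrite in_itv.
Qed.

Lemma gamma_eff_bound t j : 0 <= t -> (t%:E < T)%E ->
  exists C : R, forall s, 0 <= s <= t ->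
    `|gamma_eff M (V s) (gamma s) * (ev j + le (V s))| <= C.
Proof.
move=> t0 tT; have [C1 hC1] := contraction_rate_bound j t0 tT.
have [C2 hC2] := sgd_gamma hV t0 tT.
exists (C2 * C1) => s st; rewrite /gamma_eff -/(slope M (V s)) -mulrA normrM.
by apply: ler_pM => //; [exact: hC2|exact: hC1].
Qed.

Lemma forcing_ge0 s j : 0 <= s -> (s%:E < T)%E ->
  0 <= 2 * ev j * (mult M j)%:R * (gamma s ^+ 2 / d%:R) * adv_risk M (V s).
Proof.
move=> s0 sT; have [r0 b0] := sgd_risk hV s0 sT.
apply: mulr_ge0.
  rewrite mulr_ge0 ?divr_ge0 ?sqr_ge0 ?ler0n// mulr_ge0 ?ler0n//.
  by rewrite mulr_ge0 ?(eigval_ge0 hM).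
rewrite adv_risk_Phi// mulr_ge0//; first by rewrite ltW// slope_gt0.
rewrite addr_ge0 ?ltW// mulr_gt0// divr_gt0//; exact: lambda_eff_gt0.
Qed.

Lemma cauchy_schwarz_invariant t j : 0 <= t -> (t%:E < T)%E ->
  V12 (V t) j ^+ 2 <= V11 (V t) j * V22 M j.
Proof.
move=> t0 tT; rewrite -subr_ge0.
have [C hC] := gamma_eff_bound j t0 tT.
pose f s := V11 (V s) j * V22 M j - V12 (V s) j ^+ 2.
apply: (@gronwall_ge0 _ f t (2 * C)) => //.
- apply/subspace_continuousP => s st.
  have c11 := (subspace_continuousP _ _).1 (@within_V11 t j tT) s st.
  have c12 := (subspace_continuousP _ _).1 (@within_V12 t j tT) s st.
  apply: cvgB; first by apply: cvgM c11 _; exact: cvg_cst.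
  exact: (cvgM c12 c12).
- rewrite /f (sgd_init hV) subr_ge0.
  by have [] := admissible_state_of hM X0 j.
move=> s /andP[s0 st]; have [_ sT] : 0 <= s /\ (s%:E < T)%E.
  by apply: before_end tT; rewrite s0 ltW.
have F0 : h @[h --> 0^'+] --> (0 : R) by exact: cvg_within.
have Fn0 : \forall h \near (0 : R)^'+, h != 0 by exact: nbhs_right_neq.
have q11 := @sgd_ode11 _ _ _ _ _ _ _ _ hV s j s0 sT; have q12 := @sgd_ode12 _ _ _ _ _ _ _ _ hV s j s0 sT.
(* In [V11' V22 - 2 V12 V12'] the terms in [lambda_j V12 V22] cancel, which leaves this multiple of
   the determinant plus the noise term times [V22]. *)
exists (- (2 * (gamma_eff M (V s) (gamma s) * (ev j + le (V s))))).
exists (2 * ev j * (mult M j)%:R * (gamma s ^+ 2 / d%:R) * adv_risk M (V s) * V22 M j).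
split.
- by rewrite normrN normrM ger0_norm// ler_pM2l// hC// s0 ltW.
- by rewrite mulr_ge0 ?V22_ge0 ?forcing_ge0.
pose w := drift M (V s) (gamma s).
have qf : right_derivative f s (V11 w j * V22 M j + V11 (V s) j * 0
    + - (V12 w j * V12 (V s) j + V12 (V s) j * V12 w j)).
  apply: quotient_cvgD; first by apply: quotient_cvgM => //; exact: quotient_cvg_cst.
  by apply: quotient_cvgN; exact: quotient_cvgM.
rewrite [X in right_derivative _ _ X](_ : _ = V11 w j * V22 M j + V11 (V s) j * 0
    + - (V12 w j * V12 (V s) j + V12 (V s) j * V12 w j))//.
by rewrite /w /f /=; ring.
Qed.

(** If [V22 > 0] the Cauchy-Schwarz bound suffices. If [V22 = 0] it forces [V12 = 0] at all earlier
    times, and the equation for [V11] is then linear with nonnegative forcing. *)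
Lemma V11_ge0 t j : 0 <= t -> (t%:E < T)%E -> 0 <= V11 (V t) j.
Proof.
move=> t0 tT; have := cauchy_schwarz_invariant j t0 tT.
have [V220 _|V220] := eqVneq (V22 M j) 0; last first.
  move=> /(le_trans (sqr_ge0 _)); rewrite pmulr_lge0//.
  by rewrite lt0r V220 V22_ge0.
have [C hC] := gamma_eff_bound j t0 tT.
apply: (@gronwall_ge0 _ (fun s => V11 (V s) j) t (2 * C)) => //.
- exact: within_V11.
- by rewrite (sgd_init hV); have [] := admissible_state_of hM X0 j.
move=> s /andP[s0 st]; have [_ sT] : 0 <= s /\ (s%:E < T)%E.
  by apply: before_end tT; rewrite s0 ltW.
have V120 : V12 (V s) j = 0.
  have := cauchy_schwarz_invariant j s0 sT.
  by rewrite V220 mulr0 => h; apply/eqP; rewrite -sqrf_eq0 eq_le h sqr_ge0.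
have q11 := @sgd_ode11 _ _ _ _ _ _ _ _ hV s j s0 sT.
exists (- (2 * (gamma_eff M (V s) (gamma s) * (ev j + le (V s))))).
exists (2 * ev j * (mult M j)%:R * (gamma s ^+ 2 / d%:R) * adv_risk M (V s)).
split; [|exact: forcing_ge0|].
- by rewrite normrN normrM ger0_norm// ler_pM2l// hC// s0 ltW.
rewrite [X in right_derivative _ _ X](_ : _ = V11 (drift M (V s) (gamma s)) j)//.
by rewrite /= V120; ring.
Qed.

Lemma admissible_sgd t : 0 <= t -> (t%:E < T)%E -> admissible M (V t).
Proof.
by move=> t0 tT j; split; [exact: V11_ge0|exact: cauchy_schwarz_invariant].
Qed.

End Invariance.

(** * Exact line search *)

Section LineSearch.
Context (R : realType) (d n : nat) (M : model R d n) (hM : valid_model M).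
Implicit Types (j : 'I_n) (v : state R n) (g : R).
Local Notation ev := (eigval M).
Local Notation le := (lambda_eff M).

Definition curvature v : R := \sum_j (mult M j)%:R / d%:R * ev j * (ev j + le v).

Lemma curvature_gt0 v : (0 < d)%N -> 0 < le v -> (exists j, 0 < ev j) ->
  0 < curvature v.
Proof.
move=> d0 l0 [j evj]; rewrite /curvature (bigD1 j)//=; apply: ltr_pwDl.
  rewrite !mulr_gt0 ?invr_gt0 ?ltr0n// ?(mult_gt0 hM)//.
  exact: eigval_ridge_gt0.
apply: sumr_ge0 => i _; apply: mulr_ge0; last by rewrite ltW// eigval_ridge_gt0.
by rewrite mulr_ge0 ?divr_ge0// (eigval_ge0 hM).
Qed.

(** In each eigenspace the terms linear in [g] combine into
    [-2 gamma_eff (lambda_j + lambda_eff) E_j]; only the noise term of the [V11] equation is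
    quadratic. *)
Lemma Phi_gradient_drift v g : 0 < le v ->
  Phi_gradient M v (drift M v g) =
  adv_risk M v * curvature v * g ^+ 2
  - 2 * (slope M v * \sum_j excess_part M v j * (ev j + le v)) * g.
Proof.
move=> l0; rewrite /Phi_gradient /curvature !mulr_sumr !mulr_suml -sumrB.
apply: eq_bigr => j _; have lj := eigval_ridge_gt0 hM j l0.
rewrite /drift /gamma_eff -/(slope M v) /excess_part /=.
move: (slope M v) (adv_risk M v) (mult M j)%:R (d%:R : R)^-1 => c A m D.
by field; rewrite gt_eqF.
Qed.

Lemma line_searchP v g : (0 < d)%N -> 0 < risk M v -> 0 < B44 v ->
  (exists j, 0 < ev j) -> 0 < excess M v ->
  is_line_search M v g <->
  g = (\sum_j alpha M v j * (ev j + le v)) / curvature v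
      * (1 - Phi_min M (le v) / Phi M (le v) v).
Proof.
move=> d0 r0 b0 evp E0; have l0 := lambda_eff_gt0 hM r0 b0.
have c0 := slope_gt0 hM r0 b0; have k0 := curvature_gt0 d0 l0 evp.
have P0 : 0 < Phi M (le v) v by rewrite addr_gt0// mulr_gt0// divr_gt0.
have A0 : 0 < adv_risk M v by rewrite adv_risk_Phi// mulr_gt0.
(* The claimed rate is brought to the form [b / a]. The excess cancels against the denominators of
   the [alpha], and [slope * Phi] becomes the adversarial risk. *)
have -> : (\sum_j alpha M v j * (ev j + le v)) / curvature v
      * (1 - Phi_min M (le v) / Phi M (le v) v) =
  slope M v * (\sum_j excess_part M v j * (ev j + le v)) / (adv_risk M v * curvature v).
  have -> : \sum_j alpha M v j * (ev j + le v) =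
      (excess M v)^-1 * \sum_j excess_part M v j * (ev j + le v).
    by rewrite mulr_sumr; apply: eq_bigr => j _; rewrite /alpha; ring.
  have -> : 1 - Phi_min M (le v) / Phi M (le v) v = excess M v / Phi M (le v) v.
    by rewrite /excess mulrBl divff// gt_eqF.
  by rewrite adv_risk_Phi//; field; rewrite !gt_eqF.
have := argmin_quadratic (slope M v * \sum_j excess_part M v j * (ev j + le v)) g
  c0 (mulr_gt0 A0 k0).
move=> <-; split=> h g'; have := h g';
  by rewrite !adv_risk_rateE// !Phi_gradient_drift.
Qed.

Lemma sum_single (F : 'I_n -> R) j : n = 1%N -> \sum_i F i = F j.
Proof.
move=> n1; rewrite (bigD1 j)//= big1 ?addr0// => i /eqP[]; apply: ord_inj.
by apply/eqP; rewrite eqn_leq; move: (ltn_ord i) (ltn_ord j); lia.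
Qed.

Lemma excess_sum v : 0 < le v -> excess M v = \sum_j excess_part M v j.
Proof. by move=> l0; rewrite /excess (Phi_decomposition hM v l0) addrC addKr. Qed.

(** With one eigenvalue the only [alpha] is 1 and the multiplicity is [d], so the factors
    [lambda + lambda_eff] cancel. *)
Lemma line_search_isotropic v g j : n = 1%N -> (0 < d)%N -> 0 < risk M v ->
  0 < B44 v -> 0 < ev j -> 0 < excess M v ->
  is_line_search M v g <->
  g = (ev j)^-1 * (1 - Phi_min M (le v) / Phi M (le v) v).
Proof.
move=> n1 d0 r0 b0 ej E0; have l0 := lambda_eff_gt0 hM r0 b0.
have -> : (ev j)^-1 = (\sum_i alpha M v i * (ev i + le v)) / curvature v.
  rewrite /curvature !(sum_single _ j n1) (mult_single hM)//.
  rewrite /alpha excess_sum// (sum_single _ j n1) divff ?mul1r; last first.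
    by rewrite gt_eqF//; move: E0; rewrite excess_sum// (sum_single _ j n1).
  rewrite divff ?pnatr_eq0 -?lt0n// mul1r.
  by field; rewrite !gt_eqF// eigval_ridge_gt0.
by apply: line_searchP => //; exists j.
Qed.

End LineSearch.

(** * Optimality at zero excess risk *)

Section GlobalMinimum.
Context (R : realType) (d n : nat) (M : model R d n) (hM : valid_model M).
Implicit Types (X Y : 'cV[R]_d) (l : R).
Local Notation K := (cov M).
Local Notation ev := (eigval M).
Local Notation Xs := (target M).

Lemma ridge_normal_equation l : 0 < l ->
  K *m (ridge_minimizer M l - Xs) + l *: ridge_minimizer M l = 0.
Proof.
move=> l0; rewrite mulmxBr addrAC; apply/eqP; rewrite subr_eq0; apply/eqP.
rewrite {2}(cov_spectral hM) mulmx_suml /ridge_minimizer mulmx_sumr scaler_sumr.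
rewrite -big_split/=; apply: eq_bigr => j _.
rewrite -scalemxAr mulmxA (cov_eigproj hM) -!scalemxAl !scalerA -scalerDl.
by congr (_ *: _); field; rewrite gt_eqF// eigval_ridge_gt0.
Qed.

Lemma dotv_covC X Y : dotv X (K *m Y) = dotv Y (K *m X).
Proof. by rewrite dotvC dotv_mulmx ?(valid_cov hM).1. Qed.

Lemma risk_state_of_ge0 X : 0 <= risk M (state_of M X).
Proof.
rewrite (risk_state_of hM) addr_ge0 ?divr_ge0 ?sqr_ge0//.
by rewrite mulr_ge0 ?invr_ge0 ?(valid_cov hM).2.
Qed.

Lemma B44_state_of_ge0 X : 0 <= B44 (state_of M X).
Proof. by rewrite (B44_state_of hM) sqnorm_ge0. Qed.

(** Cauchy-Schwarz for the semi-inner product of [K], with the noise level appended as a common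
    extra coordinate of both residuals. *)
Lemma cauchy_schwarz_risk X Y :
  (dotv (X - Xs) (K *m (Y - Xs)) + noise M ^+ 2) ^+ 2 <=
  (2 * risk M (state_of M X)) * (2 * risk M (state_of M Y)).
Proof.
apply: discriminant_le => s t; rewrite !(risk_state_of hM).
move: (X - Xs) (Y - Xs) => x y; have := (valid_cov hM).2 (s *: x + t *: y).
rewrite mulmxDr dotvDl !dotvDr -!scalemxAr !dotvZl !dotvZr.
rewrite (dotv_covC y x) => h.
have := sqr_ge0 (noise M * (s + t)); move: h.
move: (dotv _ _) (dotv _ _) (dotv _ _) (noise M) => a b c e; lra.
Qed.

Lemma cauchy_schwarz_B44 X Y :
  dotv X Y ^+ 2 <= B44 (state_of M X) * B44 (state_of M Y).
Proof.
rewrite !(B44_state_of hM); apply: discriminant_le => s t.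
have := sqnorm_ge0 (s *: X + t *: Y).
by rewrite /sqnorm dotvDl !dotvDr !dotvZl !dotvZr (dotvC Y X); lra.
Qed.

(* [R^Adv] is a convex nondecreasing function of [r = sqrt (2 R)] and
   [b = sqrt B] (this uses [2 / pi <= 1]), and its gradient at [X] is [slope]
   times that of [Phi], which vanishes at the ridge minimizer. *)
Lemma ridge_minimizer_adv_risk v :
  0 < risk M v -> 0 < B44 v ->
  v = state_of M (ridge_minimizer M (lambda_eff M v)) ->
  forall Y, adv_risk M v <= adv_risk M (state_of M Y).
Proof.
move=> r0 b0 vE Y; have l0 := lambda_eff_gt0 hM r0 b0.
have c0 := slope_gt0 hM r0 b0; have cl := slope_lambda_eff hM r0 b0.
have [r [b [r1 b1 rE bE [qE sE]]]] := sqrt_coordinates r0 b0.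
have := ridge_normal_equation l0; set l := lambda_eff M v in vE l0 cl *.
set X := ridge_minimizer M l in vE *; move=> normal.
have rY := risk_state_of_ge0 Y; have bY := B44_state_of_ge0 Y.
set r' := Num.sqrt (2 * risk M (state_of M Y)).
set b' := Num.sqrt (B44 (state_of M Y)).
have r'0 : 0 <= r' by exact: sqrtr_ge0.
have b'0 : 0 <= b' by exact: sqrtr_ge0.
have rE' : risk M (state_of M Y) = r' ^+ 2 / 2.
  by rewrite sqr_sqrtr ?mulr_ge0//; field.
have bE' : B44 (state_of M Y) = b' ^+ 2 by rewrite sqr_sqrtr.
have sE' : Num.sqrt (2 * B44 (state_of M Y) * risk M (state_of M Y)) = b' * r'.
  by rewrite -sqrtrM//; congr Num.sqrt; ring.
have csr : dotv (X - Xs) (K *m (Y - Xs)) + noise M ^+ 2 <= r * r'.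
  have := cauchy_schwarz_risk X Y; rewrite -vE rE rE'.
  rewrite (_ : 2 * (r ^+ 2 / 2) * (2 * (r' ^+ 2 / 2)) = (r * r') ^+ 2); last by field.
  by apply: le_of_sqr; rewrite mulr_ge0// ltW.
have csb : dotv X Y <= b * b'.
  have := cauchy_schwarz_B44 X Y; rewrite -vE bE bE' -exprMn.
  by apply: le_of_sqr; rewrite mulr_ge0// ltW.
(* The normal equation paired with [Y - X] turns the left side into mixed products, which the two
   Cauchy-Schwarz bounds control. *)
have first_order : r ^+ 2 + l * b ^+ 2 <= r * r' + l * (b * b').
  have : r ^+ 2 + l * b ^+ 2 = dotv (X - Xs) (K *m (Y - Xs)) + noise M ^+ 2 + l * dotv X Y.
    have -> : r ^+ 2 = dotv (X - Xs) (K *m (X - Xs)) + noise M ^+ 2.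
      have := rE; rewrite {1}vE (risk_state_of hM); lra.
    have -> : b ^+ 2 = dotv X X by rewrite -bE vE (B44_state_of hM).
    have : dotv (Y - X) (K *m (X - Xs) + l *: X) = 0 by rewrite normal dotv0r.
    rewrite dotvDr dotvZr -(dotv_covC (X - Xs)) !(dotvC (Y - X) X).
    have -> : Y - X = (Y - Xs) - (X - Xs) by rewrite opprB addrA subrK.
    rewrite mulmxBr !dotvBr; lra.
  have := ler_wpM2l (ltW l0) csb; lra.
pose k := Defs.radius M * Num.sqrt (2 / pi).
have k0 : 0 < k by exact: radius_coef_gt0.
have k2 : k ^+ 2 <= Defs.radius M ^+ 2.
  rewrite exprMn sqr_sqrtr ?divr_ge0 ?pi_ge0// ler_piMr ?sqr_ge0//.
  by rewrite ler_pdivrMr ?pi_gt0// mul1r pi_ge2.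
rewrite /adv_risk sE sE' rE rE' bE bE' -/k.
(* The partial derivatives of the adversarial risk in [(r, b)] are [slope] times [r] and [l b],
   those of [Phi]. *)
have s1 : r * slope M v = r + k * b by rewrite /slope -/k qE; field; rewrite gt_eqF.
have s2 : b * (slope M v * l) = k * r + Defs.radius M ^+ 2 * b.
  by rewrite cl -/k qE; field; rewrite !gt_eqF.
have grad : 0 <= (r + k * b) * (r' - r) + (k * r + Defs.radius M ^+ 2 * b) * (b' - b).
  rewrite -s1 -s2.
  have -> : r * slope M v * (r' - r) + b * (slope M v * l) * (b' - b) =
    slope M v * (r * r' + l * (b * b') - (r ^+ 2 + l * b ^+ 2)) by ring.
  by rewrite mulr_ge0 ?subr_ge0// ltW.
have hess : 0 <= (r' - r) ^+ 2 + 2 * k * (r' - r) * (b' - b)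
    + Defs.radius M ^+ 2 * (b' - b) ^+ 2.
  have := sqr_ge0 (r' - r + k * (b' - b)).
  have := ler_wpM2r (sqr_ge0 (b' - b)) k2; lra.
(* For a quadratic polynomial the increment is exactly [grad + hess / 2]. *)
lra.
Qed.

End GlobalMinimum.

(** * Assembly along a trajectory *)

Theorem proposition5p1 (R : realType) (d n : nat) (hn : (0 < n <= d)%N)
    (M : model R d n) (hM : valid_model M) (X0 : 'cV[R]_d) (gamma : R -> R)
    (T : \bar R) (V : R -> state R n) (hV : sgd_limit M X0 gamma T V)
    (t : R) (ht0 : 0 <= t) (htT : (t%:E < T)%E) :
  let v := V t in
  let le := lambda_eff M v in
  [/\ (* adv_risk_rate is the time derivative of R^Adv along the dynamics *)
      right_derivative (fun s => adv_risk M (V s)) t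
        (adv_risk_rate M v (gamma t)),
      (* Phi is the ridge objective with parameter le, and Phi_min its minimum *)
      [/\ forall X : 'cV[R]_d, Phi M le (state_of M X) = ridge_objective M le X,
          exists X : 'cV[R]_d, ridge_objective M le X = Phi_min M le
        & forall X : 'cV[R]_d, Phi_min M le <= ridge_objective M le X],
      0 <= excess M v /\ excess M v = \sum_(j < n) excess_part M v j,
      0 < excess M v ->
        [/\ forall j : 'I_n, 0 <= alpha M v j <= 1,
            (* exact line search; K = 0 has no minimizing learning rate *)
            cov M != 0 -> forall g : R,
              is_line_search M v g <->
              g = (\sum_(j < n) alpha M v j * (eigval M j + le))
                  / (\sum_(j < n) (mult M j)%:R / d%:R * eigval M j
                                  * (eigval M j + le))
                  * (1 - Phi_min M le / Phi M le v),
            (* isotropic case K = c I, c != 0 *)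
            cov M != 0 -> n = 1%N -> forall (j : 'I_n) (g : R),
              is_line_search M v g <->
              g = (eigval M j)^-1 * (1 - Phi_min M le / Phi M le v)
          & (* isotropic case, normalized to K = I *)
            n = 1%N -> (forall j : 'I_n, eigval M j = 1) -> forall g : R,
              is_line_search M v g <-> g = 1 - Phi_min M le / Phi M le v]
    & (* zero excess risk: v is the state of a global minimizer of R^Adv *)
      excess M v = 0 ->
        exists X : 'cV[R]_d, v = state_of M X /\
          forall Y : 'cV[R]_d,
            adv_risk M (state_of M X) <= adv_risk M (state_of M Y)].
Proof.
move=> v le; have [n0 nd] := andP hn.
have d0 : (0 < d)%N by exact: leq_trans nd.
have [r0 b0] := sgd_risk hV ht0 htT.
have l0 : 0 < le := lambda_eff_gt0 hM r0 b0.
have va : admissible M v := admissible_sgd hM hV ht0 htT.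
have part0 j : 0 <= excess_part M v j := ridge_part_ge0 hM j l0 va.
have Esum : excess M v = \sum_j excess_part M v j := excess_sum hM l0.
split.
- rewrite adv_risk_rateE//.
  (* The filter is now [0^'+] and the curve is the trajectory shifted to start at [t]. *)
  apply: (@adv_risk_quotient _ _ _ _ 0^'+ _ (fun h => V (t + h))) => //.
  + exact: cvg_within.
  + exact: nbhs_right_neq.
  + by move=> j; exact: (sgd_ode11 hV).
  + by move=> j; exact: (sgd_ode12 hV).
- split; first exact: Phi_state_of.
    by exists (ridge_minimizer M le); exact: ridge_minimizerP.
  by move=> X; exact: Phi_min_le.
- by split=> //; rewrite Esum sumr_ge0.
- move=> E0; split.
  + move=> j; rewrite /alpha divr_ge0 ?(ltW E0)//= ler_pdivrMr// mul1r Esum (bigD1 j)//=.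
    by rewrite lerDl sumr_ge0.
  + by move=> K0 g; apply: line_searchP => //; exact: exists_eigval_gt0.
  + move=> K0 n1 j g; apply: line_search_isotropic => //.
    have [i ei] := exists_eigval_gt0 hM K0.
    rewrite (_ : j = i)//; apply: ord_inj.
    by apply/eqP; rewrite eqn_leq; move: (ltn_ord i) (ltn_ord j); lia.
  + move=> n1 e1 g; have j := Ordinal n0.
    have ej : 0 < eigval M j by rewrite e1.
    by have := line_search_isotropic hM g n1 d0 r0 b0 ej E0; rewrite e1 invr1 mul1r.
- move=> E0; have vE := state_ridge_minimizer hM l0 va (etrans (esym Esum) E0).
  exists (ridge_minimizer M le); split=> // Y; rewrite -vE.
  exact: ridge_minimizer_adv_risk.
Qed.
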